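(* Let $S$ be a set of $n$ sites with weights $w_1,\dots,w_n$ of minimum $1$ and total weight $W=\sum_i w_i$, placed at independent uniformly random positions on the $d$-dimensional torus $\mathbb T^d$ equipped with a $\mathfrak p$-norm. For every fixed $k$, the expected number of non-empty regions of the weighted order-$k$ Voronoi diagram of $S$ is $O(W)$ (with the constant depending only on $k,d,\mathfrak p$). The same holds for sites placed uniformly at random in the hypercube $[0,1]^d$ with the $\mathfrak p$-norm distance.
   Context: $\mathbb T^d$ is $[0,1]^d$ with opposite faces identified ($d$ a fixed constant), with distance $\mathrm{dist}(p,q)=\left(\sum_{i=1}^d|p_i-q_i|_\circ^{\mathfrak p}\right)^{1/\mathfrak p}$ (and $\max_i|p_i-q_i|_\circ$ for $\mathfrak p=\infty$), where $|a-b|_\circ=\min\{|a-b|,1-|a-b|\}$ and $\mathfrak p\in\mathbb N^+\cup\{\infty\}$ is fixed. For sites $s_1,\dots,s_n$ with weights $w_i$, let $\omega_i=w_i^{1/d}$; the weighted distance from a point $p$ to $s_i$ is $\mathrm{dist}(s_i,p)/\omega_i$. For $A\subseteq S$ with $|A|=k$, the order-$k$ Voronoi region of $A$ is the set of points $p$ for which there exists $r$ with $\mathrm{dist}(s_i,p)\le\omega_i r$ for all $s_i\in A$ and $\mathrm{dist}(s_i,p)>\omega_i r$ for all $s_i\notin A$. The weighted order-$k$ Voronoi diagram is the collection of non-empty order-$k$ regions. *)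

(* Defs.v *)
From HB Require Import structures.
From mathcomp Require Import all_boot all_order all_algebra.
From mathcomp Require Import all_classical all_reals all_analysis.
Set Implicit Arguments. Unset Strict Implicit. Unset Printing Implicit Defensive.
Import Order.TTheory GRing.Theory Num.Theory.
Local Open Scope classical_set_scope.
Local Open Scope ring_scope.

Section Voronoi.
Variable R : realType.

Definition circ_abs (a b : R) : R := Num.min `|a - b| (1 - `|a - b|).

(* coordinate-wise p-norm distance built from a 1-d distance f;
   p = Some q is the q-norm (q >= 1), p = None is the max-norm *)
Definition pdist (p : option nat) (d : nat) (f : R -> R -> R)
  (x y : 'I_d -> R) : R :=
  match p with
  | Some q => (\sum_(i < d) (f (x i) (y i)) ^+ q) `^ (q%:R^-1)
  | None => \big[Num.max/0]_(i < d) f (x i) (y i)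
  end.

Definition torus_dist (p : option nat) (d : nat) := @pdist p d circ_abs.
Definition cube_dist (p : option nat) (d : nat) := @pdist p d (fun a b : R => `|a - b|).

(* the order-k Voronoi region of A (w.r.t. sites s, multiplicative
   weights om = w^(1/d), distance dist, ambient point set dom) is non-empty *)
Definition region_nonempty (n d : nat)
  (dist : ('I_d -> R) -> ('I_d -> R) -> R) (dom : set ('I_d -> R))
  (s : 'I_n -> 'I_d -> R) (om : 'I_n -> R) (A : {set 'I_n}) : Prop :=
  exists x, dom x /\ exists r : R,
    (forall i, i \in A -> dist (s i) x <= om i * r) /\
    (forall i, i \notin A -> om i * r < dist (s i) x).

Definition num_regions (n d k : nat)
  (dist : ('I_d -> R) -> ('I_d -> R) -> R) (dom : set ('I_d -> R))
  (s : 'I_n -> 'I_d -> R) (om : 'I_n -> R) : nat :=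
  \sum_(A : {set 'I_n} | #|A| == k) `[< region_nonempty dist dom s om A >].

Definition torus_points d : set ('I_d -> R) :=
  [set x | forall j, 0 <= x j < 1].
Definition cube_points d : set ('I_d -> R) :=
  [set x | forall j, 0 <= x j <= 1].

Definition vcons (x : R) (v : nat -> R) : nat -> R :=
  fun j => if j is j'.+1 then v j' else x.

(* expectation of f(U_0,...,U_{m-1}) for i.i.d. uniform U_j on [0,1],
   as an iterated Lebesgue integral (equal to the product-measure
   integral by Fubini-Tonelli for measurable nonnegative f) *)
Fixpoint unif_expect (m : nat) (f : (nat -> R) -> \bar R) : \bar R :=
  match m with
  | 0 => f (fun _ => 0)
  | m'.+1 => (\int[@lebesgue_measure R]_(x in `[(0:R)%R, (1:R)%R]) unif_expect m' (fun v => f (vcons x v)))%E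
  end.

Definition sites_of (n d : nat) (v : nat -> R) : 'I_n -> 'I_d -> R :=
  fun i j => v (i * d + j)%N.

Definition omega (d n : nat) (w : 'I_n -> R) : 'I_n -> R :=
  fun i => w i `^ (d%:R^-1).

Definition expected_regions (n d k : nat)
  (dist : ('I_d -> R) -> ('I_d -> R) -> R) (dom : set ('I_d -> R))
  (w : 'I_n -> R) : \bar R :=
  unif_expect (n * d) (fun v =>
    ((num_regions k dist dom (@sites_of n d v) (omega d w))%:R)%:E).

End Voronoi.

(* Main.v *)
(** Cut the unit cube by a grid of mesh 1/M, with M^d of order W, and bound by a
    constant the expected number of regions having a point in a given cell. Let A be
    such a region, x a point of it in the cell, r the least radius such that every
    site i of A is within omega_i r of x, and i0 a site attaining it. Up to rounding x to the
    corner of its cell and r to a power of 4, the sites of A lie in boxes of side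
    ~ omega_i r around the corner, while i0 and the sites outside A avoid boxes of
    comparable side. In terms of la_i = w_i r^d these independent events have
    probability at most min(1, C la_i) for the sites of B := A \ i0, at most
    C' la_i exp(-c la_i) for i0 and at most exp(-c la_i) otherwise, up to a factor
    exp(w_i / M^d) that accounts for the smallest scale and is harmless since the
    exponents sum up to at most 1. Summing over i0 and B gives
      sum_{|B| = k-1} prod_{i in B} min(1, C la_i) * L_B exp(-c L_B),
    where L_B is the sum of la_i over i outside B. If B misses the heaviest site then
    L_B is at least a fraction 1/k of the total; otherwise discard the heaviest site
    and induct on k. Each resulting term is summable over the geometric scales of r,
    uniformly in the weights. *)

Require Import Defs.
From mathcomp Require Import all_boot all_order all_algebra.
From mathcomp Require Import all_classical all_reals all_analysis.
From mathcomp Require Import ring lra.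
Set Implicit Arguments. Unset Strict Implicit. Unset Printing Implicit Defensive.
Import Order.TTheory GRing.Theory Num.Theory.
Local Open Scope classical_set_scope.
Local Open Scope ring_scope.

Section GeometricSum.
Variable R : realType.
Implicit Types c x y tau : R.

Definition gamma_density c x : R := x * expR (- (c * x)).

Lemma gamma_density_ge0 c x : 0 <= x -> 0 <= gamma_density c x.
Proof. by move=> x_ge0; rewrite mulr_ge0 ?expR_ge0. Qed.

Lemma le_gamma_density (u E C : R) c x :
  1 <= E -> 1 <= C -> 0 <= c -> 0 <= x -> u <= C * x -> u <= E * expR (- (c * x)) ->
  u <= E * (C * expR c * gamma_density c x).
Proof.
move=> E_ge1 C_ge1 c_ge0 x_ge0 u_le_linear u_le_exp.
have [x_le1|x_gt1] := leP x 1.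
  apply: le_trans u_le_linear _.
  have Cx_ge0 : 0 <= C * x by rewrite mulr_ge0// (le_trans ler01).
  rewrite -[leLHS]mul1r ler_pM// /gamma_density -mulrA ler_wpM2l ?(le_trans ler01)//.
  rewrite mulrCA ler_peMr//.
  by rewrite -expRD -expR0 ler_expR subr_ge0 ler_piMr.
apply: le_trans u_le_exp _; rewrite ler_wpM2l ?(le_trans ler01)//.
rewrite /gamma_density mulrA ler_peMl ?expR_ge0//.
rewrite mulr_ege1 ?(ltW x_gt1)// mulr_ege1//.
by rewrite -expR0 ler_expR.
Qed.

Lemma mul_expRN_le x : x * expR (- x) <= 1 - expR (- x).
Proof.
have := ler_wpM2r (expR_ge0 (- x)) (expR_ge1Dx x).
by rewrite expRxMexpNx_1 mulrDl mul1r; lra.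
Qed.

Lemma gamma_density_le_sub c x y : 0 < c -> 0 <= x -> 2 * x <= y ->
  gamma_density c x <= 2 / c * (expR (- (c / 2 * x)) - expR (- (c / 2 * y))).
Proof.
move=> c_gt0 x_ge0 xy; set u := c / 2 * x.
have expR_y_le : expR (- (c / 2 * y)) <= expR (- u) * expR (- u).
  rewrite -expRD ler_expR -opprD lerN2 /u -mulrDr ler_pM2l ?divr_gt0//.
  by lra.
have -> : gamma_density c x = 2 / c * (expR (- u) * (u * expR (- u))).
  have cxE : c * x = u + u by rewrite /u; field.
  rewrite /gamma_density cxE opprD expRD /u; field.
  by rewrite gt_eqF.
rewrite ler_pM2l ?divr_gt0//.
apply: le_trans (_ : expR (- u) * (1 - expR (- u)) <= _).
  by rewrite ler_wpM2l ?expR_ge0// mul_expRN_le.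
by rewrite mulrBr mulr1 lerD2l lerN2.
Qed.

Lemma geometric_gamma_density_sum_le c tau y J : 0 < c -> 2 <= tau -> 0 <= y ->
  \sum_(j < J) gamma_density c (tau ^+ j * y) <= 2 / c.
Proof.
move=> c_gt0 tau_ge2 y_ge0; have tau_ge0 : 0 <= tau by lra.
pose tail j := - expR (- (c / 2 * (tau ^+ j * y))).
apply: le_trans (_ : \sum_(0 <= j < J) 2 / c * (tail j.+1 - tail j) <= _).
  rewrite big_mkord; apply: ler_sum => j _; rewrite /tail opprK addrC.
  apply: gamma_density_le_sub => //; first by rewrite mulr_ge0 ?exprn_ge0.
  by rewrite exprS -mulrA ler_wpM2r// mulr_ge0 ?exprn_ge0.
rewrite -mulr_sumr telescope_sumr// ler_piMr ?divr_ge0 ?(ltW c_gt0)//.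
have tailJ_le0 : tail J <= 0 by rewrite oppr_le0 expR_ge0.
have tail0_geN1 : - 1 <= tail 0.
  by rewrite lerN2 -expR0 ler_expR oppr_le0 !mulr_ge0// ltW.
by lra.
Qed.

End GeometricSum.

Section SubsetSums.
Variables (R : realType) (I : finType).
Implicit Types (A B : {set I}) (h : I) (x : I -> R) (a c C : R).

Lemma sum_prod_subset_le_expR (P : pred {set I}) x : (forall i, 0 <= x i) ->
  \sum_(B : {set I} | P B) \prod_(i in B) x i <= expR (\sum_i x i).
Proof.
move=> x_ge0; apply: le_trans (_ : \prod_i (x i + 1) <= _); last first.
  rewrite expR_sum; apply: ler_prod => i _.
  by rewrite addr_ge0//= addrC expR_ge1Dx.
rewrite bigA_distr [leLHS]big_mkcond; apply: ler_sum => B _.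
by rewrite -big_mkcond; case: ifP => // _; exact: prodr_ge0.
Qed.

Lemma sum_subset_setU1 (V : nmodType) h (P : pred {set I}) (F : {set I} -> V) :
  \sum_(A | P A && (h \in A)) F A =
  \sum_(B : {set I} | P (h |: B)%SET && (h \notin B)) F (h |: B)%SET.
Proof.
rewrite (reindex_onto (fun B => h |: B)%SET (fun A => A :\ h)%SET) /=; last first.
  by move=> A /andP[_ hA]; rewrite finset.setD1K.
apply: eq_bigl => B; rewrite setU11 andbT; congr (_ && _).
by apply/eqP/idP => [<-|hB]; rewrite ?setD11// setU1K.
Qed.

Definition gamma_weight c C x B : R :=
  (\prod_(i in B) Num.min 1 (C * x i)) * gamma_density c (\sum_(i | i \notin B) x i).

Definition gamma_subset_sum c C m x : R :=
  \sum_(B : {set I} | #|B| == m) gamma_weight c C x B.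

Definition marked_gamma_weight c C x h B : R :=
  (\prod_(i in B) Num.min 1 (C * x i)) * (x h * expR (- (c * \sum_(i | i \notin B) x i))).

Lemma sum_marked_gamma_weight c C x B :
  \sum_(h | h \notin B) marked_gamma_weight c C x h B = gamma_weight c C x B.
Proof. by rewrite -mulr_sumr -mulr_suml. Qed.

Lemma gamma_subset_sum0 c C x :
  gamma_subset_sum c C 0 x = gamma_density c (\sum_i x i).
Proof.
rewrite /gamma_subset_sum (big_pred1 finset.set0) => [|B]; last by rewrite /= cards_eq0.
by rewrite /gamma_weight big_set0 mul1r; under eq_bigl do rewrite inE.
Qed.

Lemma prod_min1_ge0 C x B : 0 <= C -> (forall i, 0 <= x i) ->
  0 <= \prod_(i in B) Num.min 1 (C * x i).
Proof.
move=> C_ge0 x_ge0; apply: prodr_ge0 => i _.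
by rewrite le_min ler01 mulr_ge0.
Qed.

Lemma gamma_weight_ge0 c C x B : 0 <= C -> (forall i, 0 <= x i) ->
  0 <= gamma_weight c C x B.
Proof.
by move=> C_ge0 x_ge0; rewrite mulr_ge0 ?gamma_density_ge0 ?sumr_ge0 ?prod_min1_ge0.
Qed.

Lemma sum_le_card_mul_sum_notin x h B : (forall i, 0 <= x i) ->
  (forall i, x i <= x h) -> h \notin B ->
  \sum_i x i <= #|B|.+1%:R * \sum_(i | i \notin B) x i.
Proof.
move=> x_ge0 x_max hB; rewrite (bigID (mem B)) /= -natr1 mulrDl mul1r lerD2r.
rewrite mulr_natl -sumr_const; apply: ler_sum => i _.
by rewrite (le_trans (x_max i))// (bigD1 h) //= lerDl sumr_ge0.
Qed.

Lemma gamma_weight_notin_le c C a m x h B :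
  0 < a -> 2 * m.+1%:R * a <= c -> 0 <= C -> (forall i, 0 <= x i) ->
  (forall i, x i <= x h) -> #|B| = m -> h \notin B ->
  gamma_weight c C x B <=
    \prod_(i in B) (a * x i) * ((C / a) ^+ m * gamma_density (2 * a) (\sum_i x i)).
Proof.
move=> a_gt0 ac C_ge0 x_ge0 x_max cardB hB.
have := sum_le_card_mul_sum_notin x_ge0 x_max hB; rewrite cardB.
set total := \sum_i _; set outside := \sum_(i | _) _ => total_le.
have outside_ge0 : 0 <= outside by exact: sumr_ge0.
have outside_le : outside <= total.
  by rewrite /total (bigID (mem B)) /= lerDr sumr_ge0.
rewrite [leRHS]mulrA ler_pM ?prod_min1_ge0 ?gamma_density_ge0//.
  rewrite -cardB -prodr_const -big_split; apply: ler_prod => i _ /=.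
  rewrite le_min ler01 mulr_ge0//= ge_min (_ : a * _ * _ = C * x i).
    by rewrite lexx orbT.
  by field; rewrite gt_eqF.
rewrite ler_pM ?expR_ge0// ler_expR lerN2.
apply: le_trans (_ : 2 * a * (m.+1%:R * outside) <= _).
  by rewrite ler_wpM2l// mulr_ge0// ltW.
by rewrite mulrA ler_wpM2r// mulrAC.
Qed.

(* Half of the exponential decay pays for the sum over the sets B. *)
Lemma gamma_subset_sum_notin_le c C a m x h :
  0 < a -> 2 * m.+1%:R * a <= c -> 0 <= C -> (forall i, 0 <= x i) ->
  (forall i, x i <= x h) ->
  \sum_(B : {set I} | (#|B| == m) && (h \notin B)) gamma_weight c C x B <=
    (C / a) ^+ m * gamma_density a (\sum_i x i).
Proof.
move=> a_gt0 ac C_ge0 x_ge0 x_max.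
apply: le_trans (ler_sum _ _) _ => [B /andP[/eqP cardB hB]|].
  exact: gamma_weight_notin_le a_gt0 ac C_ge0 x_ge0 x_max cardB hB.
have total_ge0 : 0 <= \sum_i x i by exact: sumr_ge0.
rewrite -mulr_suml mulrCA ler_wpM2l ?exprn_ge0 ?divr_ge0 ?(ltW a_gt0)//.
rewrite mulrCA ler_wpM2l// -ler_pdivlMr ?expR_gt0// -expRN -expRD opprK.
apply: le_trans (sum_prod_subset_le_expR _ _) _ => [i|].
  by rewrite mulr_ge0// ltW.
by rewrite ler_expR -mulr_sumr; lra.
Qed.

Definition zero_at h x : I -> R := fun i => if i == h then 0 else x i.

Lemma zero_at_ge0 h x i : (forall i, 0 <= x i) -> 0 <= zero_at h x i.
Proof. by rewrite /zero_at; case: eqP. Qed.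

Lemma zero_at_scale h a x : zero_at h (fun i => a * x i) = fun i => a * zero_at h x i.
Proof. by apply/funext => i; rewrite /zero_at; case: eqP; rewrite ?mulr0. Qed.

Lemma gamma_weight_setU1_le c C x h B : 0 <= C -> (forall i, 0 <= x i) -> h \notin B ->
  gamma_weight c C x (h |: B)%SET <= gamma_weight c C (zero_at h x) B.
Proof.
move=> C_ge0 x_ge0 hB; rewrite /gamma_weight big_setU1//=.
have -> : \prod_(i in B) Num.min 1 (C * zero_at h x i) = \prod_(i in B) Num.min 1 (C * x i).
  by apply: eq_bigr => i iB; rewrite /zero_at; case: eqP iB hB => // -> ->.
have -> : \sum_(i | i \notin B) zero_at h x i = \sum_(i | i \notin (h |: B)%SET) x i.
  rewrite (bigD1 h) //= {1}/zero_at eqxx add0r; apply: eq_big => [i|i /andP[_ /negbTE i_h]].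
    by rewrite !inE negb_or andbC.
  by rewrite /zero_at i_h.
rewrite -mulrA ler_piMl ?ge_min ?lexx//.
by rewrite mulr_ge0 ?prod_min1_ge0 ?gamma_density_ge0 ?sumr_ge0.
Qed.

Lemma gamma_subset_sum_in_le c C m x h : 0 <= C -> (forall i, 0 <= x i) ->
  \sum_(B : {set I} | (#|B| == m.+1) && (h \in B)) gamma_weight c C x B <=
    gamma_subset_sum c C m (zero_at h x).
Proof.
move=> C_ge0 x_ge0; rewrite sum_subset_setU1 [leRHS](bigID (fun B => h \notin B)) /=.
rewrite -[leLHS]addr0 lerD ?sumr_ge0//; last first.
  by move=> B _; apply: gamma_weight_ge0 => // i; exact: zero_at_ge0.
under [leRHS]eq_bigl => B.
  have -> : (#|B| == m) && (h \notin B) = (#|(h |: B)%SET| == m.+1) && (h \notin B).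
    by rewrite cardsU1; case: (h \notin B); rewrite ?andbF.
  over.
by apply: ler_sum => B /andP[_ hB]; exact: gamma_weight_setU1_le.
Qed.

Lemma gamma_subset_sumS_le c C a m x h :
  0 < a -> 2 * m.+2%:R * a <= c -> 0 <= C -> (forall i, 0 <= x i) ->
  (forall i, x i <= x h) ->
  gamma_subset_sum c C m.+1 x <=
    (C / a) ^+ m.+1 * gamma_density a (\sum_i x i) +
    gamma_subset_sum c C m (zero_at h x).
Proof.
move=> a_gt0 ac C_ge0 x_ge0 x_max.
rewrite {1}/gamma_subset_sum (bigID (fun B => h \notin B)) /= lerD//.
  exact: gamma_subset_sum_notin_le.
under eq_bigl do rewrite negbK.
exact: gamma_subset_sum_in_le.
Qed.

End SubsetSums.

Lemma geometric_gamma_subset_sum_bounded (R : realType) (c C tau : R) m :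
  0 < c -> 0 <= C -> 2 <= tau ->
  exists2 K : R, 0 <= K & forall (I : finType) (y : I -> R) J, (forall i, 0 <= y i) ->
    \sum_(j < J) gamma_subset_sum c C m (fun i => tau ^+ j * y i) <= K.
Proof.
move=> c_gt0 C_ge0 tau_ge2; have tau_ge0 : 0 <= tau by lra.
elim: m => [|m [K K_ge0 sum_leK]].
  exists (2 / c) => [|I y J y_ge0]; first by rewrite divr_ge0// ltW.
  under eq_bigr do rewrite gamma_subset_sum0 -mulr_sumr.
  by apply: geometric_gamma_density_sum_le; rewrite ?sumr_ge0.
pose a := c / (2 * m.+2%:R); have a_gt0 : 0 < a by rewrite divr_gt0.
have ac : 2 * m.+2%:R * a <= c by rewrite mulrC divfK ?mulf_neq0.
have pow_ge0 : 0 <= (C / a) ^+ m.+1 by rewrite exprn_ge0 ?divr_ge0// ltW.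
have bound_ge0 : 0 <= (C / a) ^+ m.+1 * (2 / a) + K.
  by rewrite addr_ge0// mulr_ge0// divr_ge0// ltW.
exists ((C / a) ^+ m.+1 * (2 / a) + K) => // I y J y_ge0.
have [i0 _|I_empty] := pickP I; last first.
  rewrite big1 ?bound_ge0// => j _; rewrite /gamma_subset_sum big1// => B /eqP cardB.
  have /card_gt0P[i] : (0 < #|B|)%N by rewrite cardB.
  by have := I_empty i.
have [h _ h_max] := @arg_maxP _ _ _ i0 xpredT y isT.
apply: le_trans (ler_sum _ _) _ => [j _|].
  apply: (gamma_subset_sumS_le (h := h) a_gt0 ac C_ge0) => i.
    by rewrite mulr_ge0 ?exprn_ge0.
  by rewrite ler_wpM2l ?exprn_ge0//; exact: h_max.
rewrite big_split -mulr_sumr /= lerD//.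
  rewrite ler_wpM2l//; under eq_bigr do rewrite -mulr_sumr.
  by apply: geometric_gamma_density_sum_le; rewrite ?sumr_ge0.
under eq_bigr do rewrite zero_at_scale.
by apply: sum_leK => i; exact: zero_at_ge0.
Qed.

Section UniformProbability.
Variable R : realType.
Implicit Types (X Y : set R) (a b : R).

Definition unif_prob X : R := fine (@lebesgue_measure R (X `&` `[0, 1]%classic)).

Lemma lebesgue_measure_unit_itv : @lebesgue_measure R `[0, 1]%classic = 1%E.
Proof. by rewrite lebesgue_measure_itv /= lte_fin ltr01 oppr0 adde0. Qed.

Lemma unif_probE X : measurable X ->
  @lebesgue_measure R (X `&` `[0, 1]%classic) = (unif_prob X)%:E.
Proof.
move=> mX; rewrite fineK// ge0_fin_numE ?measure_ge0//.
apply: (@le_lt_trans _ _ 1%E); last by rewrite ltry.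
rewrite -lebesgue_measure_unit_itv; apply: le_measure; rewrite ?inE//.
exact: measurableI.
Qed.

Lemma unif_prob_ge0 X : 0 <= unif_prob X.
Proof. by rewrite fine_ge0. Qed.

Lemma unif_probS X Y : measurable X -> measurable Y ->
  X `&` `[0, 1]%classic `<=` Y -> unif_prob X <= unif_prob Y.
Proof.
move=> mX mY XY; rewrite -lee_fin -!unif_probE//.
apply: le_measure; rewrite ?inE; try exact: measurableI.
by move=> x Xx; split; [exact: XY|case: Xx].
Qed.

Lemma unif_probT : unif_prob setT = 1.
Proof. by rewrite /unif_prob setTI lebesgue_measure_unit_itv. Qed.

Lemma unif_prob_le1 X : measurable X -> unif_prob X <= 1.
Proof. by move=> mX; rewrite -unif_probT; exact: unif_probS. Qed.

Lemma unif_probU_le X Y : measurable X -> measurable Y ->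
  unif_prob (X `|` Y) <= unif_prob X + unif_prob Y.
Proof.
move=> mX mY; rewrite -lee_fin EFinD -!unif_probE//; last exact: measurableU.
by rewrite setIUl; apply: measureU2; exact: measurableI.
Qed.

Lemma unif_prob_itv_le a b : a <= b -> unif_prob `[a, b]%classic <= b - a.
Proof.
move=> ab; rewrite -lee_fin -unif_probE//.
apply: (@le_trans _ _ (@lebesgue_measure R `[a, b]%classic)).
  by apply: le_measure; rewrite ?inE//; exact: measurableI.
rewrite lebesgue_measure_itv /= lte_fin; case: ltP => //= _.
by rewrite lee_fin subr_ge0.
Qed.

Lemma unif_prob_itv_ge a b : 0 <= a -> b <= 1 -> b - a <= unif_prob `[a, b]%classic.
Proof.
move=> a_ge0 b_le1; have [ba|ab] := leP b a.
  by apply: le_trans (unif_prob_ge0 _); rewrite subr_le0.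
rewrite /unif_prob setIidl => [|x /=].
  by rewrite lebesgue_measure_itv /= lte_fin ab.
by rewrite !in_itv /= => /andP[ax xb]; rewrite (le_trans a_ge0)// (le_trans xb).
Qed.

Lemma integral_sum_indic (L : finType) (P : pred L) (al : L -> R) (X : L -> set R) :
  (forall l, measurable (X l)) ->
  (\int[@lebesgue_measure R]_(x in `[0%R, 1%R]) (\sum_(l | P l) al l * \1_(X l) x)%:E =
   (\sum_(l | P l) al l * unif_prob (X l))%:E)%E.
Proof.
move=> mX; set mu := @lebesgue_measure R.
have measurable_indic l := @measurable_realfun.measurable_indic _ (measurableTypeR R) R
  (`[0%R, 1%R]%classic : set R) (X l) (mX l).
have integrable_indic l : mu.-integrable `[0%R, 1%R] (fun x => (\1_(X l) x)%:E).
  apply: (@measurable_bounded_integrable _ _ _ mu (\1_(X l) : R -> R)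
    _ (measurable_itv _)) => //.
    by apply: (@le_lt_trans _ _ 1%E); [rewrite -lebesgue_measure_unit_itv|rewrite ltry].
  exists 1; split => // M M_gt1 x _ /=; apply: le_trans (ltW M_gt1).
  by rewrite indicE; case: (x \in X l); rewrite ?normr1 ?normr0.
transitivity (\int[mu]_(x in `[0%R, 1%R]) \sum_(l | P l) ((al l)%:E * (\1_(X l) x)%:E))%E.
  by apply: eq_integral => x _; rewrite -sumEFin; apply: eq_bigr => l _; rewrite EFinM.
rewrite integral_sum//; last by move=> l; exact: integrableZl.
rewrite -sumEFin; apply: eq_bigr => l _; rewrite integralZl// EFinM; congr (_ * _)%E.
by rewrite integral_indic//; [exact: (unif_probE (mX l))|exact: mX].
Qed.

End UniformProbability.

Section UniformExpectation.
Variable R : realType.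

(* The number of regions is not known to be measurable: an integral of a nonnegative
   function is a supremum over simple functions below it, hence monotone regardless. *)
Lemma ge0_le_integral_nonmeasurable d (T : measurableType d)
    (mu : {measure set T -> \bar R}) (D : set T) (f g : T -> \bar R) :
  (forall x, D x -> 0 <= f x)%E -> (forall x, D x -> f x <= g x)%E ->
  (\int[mu]_(x in D) f x <= \int[mu]_(x in D) g x)%E.
Proof.
move=> f_ge0 fg; have g_ge0 x : D x -> (0 <= g x)%E.
  by move=> Dx; exact: le_trans (f_ge0 _ Dx) (fg _ Dx).
rewrite !ge0_integralE//; apply: le_ereal_sup => _ [h hf <-]; exists h => //= x.
apply: (le_trans (hf x)); rewrite /patch; case: ifPn => //.
by rewrite inE => /fg.
Qed.

Definition unit_points : set (nat -> R) := [set v | forall c, 0 <= v c <= 1].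

Lemma unit_points_vcons x v :
  0 <= x <= 1 -> unit_points v -> unit_points (vcons x v).
Proof. by move=> x01 v01 [|c] //=; exact: v01. Qed.

Lemma unif_expect_ge0 m (f : (nat -> R) -> \bar R) :
  (forall v, unit_points v -> 0 <= f v)%E -> (0 <= unif_expect m f)%E.
Proof.
elim: m f => [|m IH] f f_ge0 /=; first by apply: f_ge0 => c; rewrite lexx ler01.
apply: integral_ge0 => x /=; rewrite in_itv /= => x01; apply: IH => v v01.
by apply: f_ge0; exact: unit_points_vcons.
Qed.

Lemma le_unif_expect m (f g : (nat -> R) -> \bar R) :
  (forall v, unit_points v -> 0 <= f v)%E ->
  (forall v, unit_points v -> f v <= g v)%E ->
  (unif_expect m f <= unif_expect m g)%E.
Proof.
elim: m f g => [|m IH] f g f_ge0 fg /=; first by apply: fg => c; rewrite lexx ler01.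
apply: ge0_le_integral_nonmeasurable => x /=; rewrite in_itv /= => x01.
  by apply: unif_expect_ge0 => v v01; apply: f_ge0; exact: unit_points_vcons.
by apply: IH => v v01; [apply: f_ge0|apply: fg]; exact: unit_points_vcons.
Qed.

Lemma unif_expect_sum_prod_indic (L : finType) (P : pred L) m (al : L -> R)
    (X : L -> nat -> set R) :
  (forall l c, measurable (X l c)) ->
  (unif_expect m (fun v => (\sum_(l | P l) al l * \prod_(c < m) \1_(X l c) (v c))%:E) =
   (\sum_(l | P l) al l * \prod_(c < m) unif_prob (X l c))%:E)%E.
Proof.
elim: m al X => [|m IH] al X mX /=.
  by congr EFin; apply: eq_bigr => l _; rewrite !big_ord0.
transitivity (\int[@lebesgue_measure R]_(x in `[0%R, 1%R]) (\sum_(l | P l)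
   (al l * \prod_(c < m) unif_prob (X l c.+1)) * \1_(X l 0%N) x)%:E)%E.
  apply: eq_integral => x _.
  under eq_fun do under eq_bigr do rewrite big_ord_recl /= mulrA.
  rewrite (IH (fun l => al l * \1_(X l 0%N) x) (fun l c => X l c.+1))//.
  by under eq_bigr do rewrite mulrAC.
rewrite integral_sum_indic//; congr EFin; apply: eq_bigr => l _.
by rewrite big_ord_recl mulrAC -mulrA.
Qed.

Lemma unif_expect_cst m (r : R) : (unif_expect m (fun=> r%:E) = r%:E)%E.
Proof.
elim: m => //= m IH; rewrite (_ : (fun _ => _) = cst r%:E); last exact/funext.
rewrite integral_cst// -[RHS]mule1; congr (_ * _)%E.
exact: lebesgue_measure_unit_itv.
Qed.

End UniformExpectation.

Lemma indic_setD (R : pzRingType) (T : Type) (A B : set T) x : B `<=` A ->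
  \1_(A `\` B) x = \1_A x - \1_B x :> R.
Proof.
move=> BA; rewrite !indicE in_setD.
have [/set_mem/BA/mem_set->|_] := boolP (x \in B); first by rewrite subrr.
by rewrite andbT subr0.
Qed.

Lemma big_ord_mul (T : Type) (idx : T) (op : Monoid.law idx) n d (F : nat -> T) :
  \big[op/idx]_(c < n * d) F c =
  \big[op/idx]_(i < n) \big[op/idx]_(j < d) F (i * d + j)%N.
Proof.
rewrite -(big_mkord xpredT F) big_nat_mul big_mkord; apply: eq_bigr => i _.
rewrite -{1}[(i * d)%N]add0n big_addn mulSn addnK big_mkord.
by apply: eq_bigr => j _; rewrite addnC.
Qed.

Section UniformBoxes.
Variable R : realType.

Definition box d (X : 'I_d -> set R) : set ('I_d -> R) := [set x | forall j, X j (x j)].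

Definition box_prob d (X : 'I_d -> set R) : R := \prod_(j < d) unif_prob (X j).

Lemma box_prob_ge0 d (X : 'I_d -> set R) : 0 <= box_prob X.
Proof. by apply: prodr_ge0 => j _; exact: unif_prob_ge0. Qed.

Lemma indic_box d (X : 'I_d -> set R) x :
  \1_(box X) x = \prod_(j < d) \1_(X j) (x j) :> R.
Proof.
rewrite indicE; have [/set_mem boxXx|xNbox] := boolP (x \in box X).
  by rewrite big1// => j _; rewrite indicE mem_set//; exact: boxXx.
have /existsNP[j Xxj] : ~ box X x by move=> /mem_set; exact/negP.
by rewrite (bigD1 j)//= indicE memNset// mul0r.
Qed.

Lemma unif_expect_sum_prod_box (L B : finType) (P : pred L) n d
    (al : L -> 'I_n -> B -> R) (X : L -> 'I_n -> B -> 'I_d -> set R) :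
  (forall l i b j, measurable (X l i b j)) ->
  unif_expect (n * d) (fun v => (\sum_(l | P l) \prod_(i < n) \sum_b
     al l i b * \1_(box (X l i b)) (sites_of v i))%:E) =
  (\sum_(l | P l) \prod_(i < n) \sum_b al l i b * box_prob (X l i b))%:E.
Proof.
move=> mX; pose factor (e : L * {ffun 'I_n -> B}) (c : nat) : set R :=
  match insub (c %/ d)%N, insub (c %% d)%N with
  | Some i, Some j => X e.1 i (e.2 i) j
  | _, _ => setT
  end.
have factorE e (i : 'I_n) (j : 'I_d) : factor e (i * d + j)%N = X e.1 i (e.2 i) j.
  have d_gt0 : (0 < d)%N by case: d j {X mX factor} => [[]|].
  by rewrite /factor divnMDl// modnMDl divn_small// modn_small// addn0 !valK.
have expand (g : nat -> set R -> R) :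
    \sum_(l | P l) \prod_(i < n) \sum_b
      al l i b * \prod_(j < d) g (i * d + j)%N (X l i b j) =
    \sum_(e : L * {ffun 'I_n -> B} | P e.1)
      (\prod_(i < n) al e.1 i (e.2 i)) * \prod_(c < n * d) g c (factor e c).
  under eq_bigr do rewrite bigA_distr_bigA.
  rewrite pair_big_dep; apply: eq_big => [e|e _] /=; first by rewrite andbT.
  rewrite (big_ord_mul _ n d (fun c => g c (factor e c))) -big_split.
  apply: eq_bigr => i _ /=; congr (_ * _).
  by apply: eq_bigr => j _; rewrite factorE.
rewrite (expand (fun _ => @unif_prob R)) -unif_expect_sum_prod_indic => [|e c].
  congr unif_expect; apply/funext => v; congr EFin.
  rewrite -(expand (fun c A => \1_A (v c))).
  by under eq_bigr do under eq_bigr do under eq_bigr do rewrite indic_box.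
by rewrite /factor; case: insub => // i; case: insub.
Qed.

Lemma unif_expect_sum_prod_box_setD (L : finType) (P : pred L) n d
    (X Y : L -> 'I_n -> 'I_d -> set R) :
  (forall l i j, measurable (X l i j)) -> (forall l i j, measurable (Y l i j)) ->
  (forall l i, box (Y l i) `<=` box (X l i)) ->
  unif_expect (n * d) (fun v =>
    (\sum_(l | P l) \prod_(i < n) \1_(box (X l i) `\` box (Y l i)) (sites_of v i))%:E) =
  (\sum_(l | P l) \prod_(i < n) (box_prob (X l i) - box_prob (Y l i)))%:E.
Proof.
move=> mX mY YX.
have := @unif_expect_sum_prod_box L bool P n d (fun _ _ b => if b then 1 else -1)
  (fun l i b => if b then X l i else Y l i).
under eq_fun do under eq_bigr do under eq_bigr do rewrite big_bool mul1r mulN1r.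
under [in RHS]eq_bigr do under eq_bigr do rewrite big_bool mul1r mulN1r.
move=> <-; last by move=> l i [].
congr unif_expect; apply/funext => v; congr EFin.
by apply: eq_bigr => l _; apply: eq_bigr => i _; rewrite indic_setD.
Qed.

End UniformBoxes.

Section CoordinatewiseDistance.
Variable R : realType.

Lemma powR_invnK n (x : R) : (0 < n)%N -> 0 <= x -> (x `^ n%:R^-1) ^+ n = x.
Proof.
move=> n_gt0 x_ge0; rewrite -powR_mulrn ?powR_ge0// -powRrM mulVf ?powRr1//.
by rewrite pnatr_eq0 -lt0n.
Qed.

Variables (p : option nat) (d : nat) (f : R -> R -> R) (x y : 'I_d -> R).
Hypothesis p_gt0 : forall q, p = Some q -> (0 < q)%N.
Hypothesis f_ge0 : forall j, 0 <= f (x j) (y j).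

Let sum_exprn_ge0 q : 0 <= \sum_(j < d) f (x j) (y j) ^+ q.
Proof. by apply: sumr_ge0 => j _; exact: exprn_ge0. Qed.

Lemma le_pdist j : f (x j) (y j) <= pdist p f x y.
Proof.
case: p p_gt0 => [q /(_ q erefl) q_gt0|_] /=; last first.
  exact: (le_bigmax _ (fun i => f (x i) (y i))).
rewrite -(ler_pXn2r q_gt0) ?nnegrE ?powR_ge0// powR_invnK//.
by rewrite (bigD1 j) //= lerDl; apply: sumr_ge0 => i _; exact: exprn_ge0.
Qed.

Lemma pdist_le m : (0 < d)%N -> (forall j, f (x j) (y j) <= m) -> pdist p f x y <= d%:R * m.
Proof.
move=> d_gt0 f_le; have m_ge0 : 0 <= m by exact: le_trans (f_ge0 (Ordinal d_gt0)) (f_le _).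
have d_ge1 : 1 <= d%:R :> R by rewrite ler1n.
case: p p_gt0 => [q /(_ q erefl) q_gt0|_] /=; last first.
  by apply: bigmax_le => [|j _]; rewrite ?mulr_ge0// (le_trans (f_le j))// ler_peMl.
rewrite -(ler_pXn2r q_gt0) ?nnegrE ?powR_ge0 ?mulr_ge0// powR_invnK//.
apply: (@le_trans _ _ (\sum_(j < d) m ^+ q)).
  by apply: ler_sum => j _; rewrite lerXn2r ?nnegrE.
rewrite sumr_const card_ord -[leLHS]mulr_natl exprMn ler_wpM2r ?exprn_ge0//.
by rewrite -[leLHS]expr1 ler_weXn2l.
Qed.

End CoordinatewiseDistance.

Section IntervalDistance.
Variable R : realType.
Implicit Types a b c e r : R.

(* Sandwiching f between the circle and the line metrics treats the torus and
   the cube at once: ball volumes are bounded above through the former, below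
   through the latter. *)
Definition interval_distance (f : R -> R -> R) : Prop :=
  [/\ forall a b, 0 <= a <= 1 -> 0 <= b <= 1 -> circ_abs a b <= f a b <= `|a - b|,
      forall a b c, 0 <= a <= 1 -> 0 <= b <= 1 -> 0 <= c <= 1 -> f a c <= f a b + f b c
    & forall c r, measurable [set a | f a c <= r]].

Lemma circ_abs_le a c r : (circ_abs a c <= r) = (`|a - c| <= r) || (1 - r <= `|a - c|).
Proof. by rewrite /circ_abs ge_min; congr (_ || _); rewrite !lerBlDr addrC. Qed.

Lemma unit_perimeter_le2 a b c : 0 <= a <= 1 -> 0 <= b <= 1 -> 0 <= c <= 1 ->
  `|a - b| + `|b - c| + `|a - c| <= 2.
Proof.
move=> a01 b01 c01; case: (ger0P (a - b)) => ?; case: (ger0P (b - c)) => ?;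
  case: (ger0P (a - c)) => ?; lra.
Qed.

Lemma circ_abs_triangle a b c : 0 <= a <= 1 -> 0 <= b <= 1 -> 0 <= c <= 1 ->
  circ_abs a c <= circ_abs a b + circ_abs b c.
Proof.
move=> a01 b01 c01; have := unit_perimeter_le2 a01 b01 c01.
have ac_le := ler_distD b a c; have bc_le := ler_distD a b c.
have ab_le := ler_distD c a b; move: bc_le ab_le.
rewrite (distrC b a) (distrC c b) /circ_abs => bc_le ab_le perimeter_le.
case: (leP `|a - b|) => ?; case: (leP `|b - c|) => ?; case: (leP `|a - c|) => ?; lra.
Qed.

Lemma interval_distance_norm : interval_distance (fun a b => `|a - b|).
Proof.
split=> [a b _ _|a b c _ _ _|c r]; first by rewrite lexx andbT /circ_abs ge_min lexx.
  exact: ler_distD.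
rewrite (_ : [set a | _] = `[c - r, c + r]%classic)//.
by apply/seteqP; split => a /=; rewrite in_itv /= ler_distl.
Qed.

Lemma interval_distance_circ : interval_distance (@circ_abs R).
Proof.
split=> [a b _ _|a b c|c r]; first by rewrite lexx /circ_abs ge_min lexx.
  exact: circ_abs_triangle.
rewrite (_ : [set a | _] = `[c - r, c + r]%classic `|`
    (`]-oo, c - (1 - r)]%classic `|` `[c + (1 - r), +oo[%classic)).
  by apply: measurableU => //; exact: measurableU.
apply/seteqP; split => a /=.
  rewrite circ_abs_le ler_distl ler_normr !in_itv /= andbT.
  by case/or3P => ?; [left|right; right|right; left]; lra.
rewrite circ_abs_le ler_distl ler_normr !in_itv /= andbT.
by case=> [->//|[?|?]]; apply/or3P; [apply: Or33|apply: Or32]; lra.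
Qed.

Variable f : R -> R -> R.
Hypothesis fP : interval_distance f.

Definition dist_ball c r : set R := [set a | f a c <= r].

Lemma measurable_dist_ball c r : measurable (dist_ball c r).
Proof. by case: fP => _ _; exact. Qed.

Lemma interval_distance_ge0 a b : 0 <= a <= 1 -> 0 <= b <= 1 -> 0 <= f a b.
Proof.
move=> a01 b01; case: fP => /(_ _ _ a01 b01)/andP[+ _] _ _; apply: le_trans.
by rewrite /circ_abs le_min normr_ge0 /= subr_ge0 ler_distl; lra.
Qed.

Lemma interval_distance_le_norm a b : 0 <= a <= 1 -> 0 <= b <= 1 -> f a b <= `|a - b|.
Proof. by move=> a01 b01; case: fP => /(_ _ _ a01 b01)/andP[]. Qed.

Lemma interval_distance_le1 a b : 0 <= a <= 1 -> 0 <= b <= 1 -> f a b <= 1.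
Proof.
move=> a01 b01; apply: (le_trans (interval_distance_le_norm a01 b01)).
by rewrite ler_distl; lra.
Qed.

Lemma interval_distance_leD a b c e : 0 <= a <= 1 -> 0 <= b <= 1 -> 0 <= c <= 1 ->
  `|b - c| <= e -> f a c <= f a b + e.
Proof.
move=> a01 b01 c01 bc; case: (fP) => _ /(_ a b c a01 b01 c01) fac _.
by apply: (le_trans fac); rewrite lerD2l (le_trans _ bc)// interval_distance_le_norm.
Qed.

Lemma unif_prob_dist_ball_le c r : 0 <= c <= 1 -> 0 <= r ->
  unif_prob (dist_ball c r) <= 4 * r.
Proof.
move=> c01 r_ge0.
pose center := `[c - r, c + r]%classic : set R.
pose left_end := `[0, r]%classic : set R.
pose right_end := `[1 - r, 1]%classic : set R.
have mcenter : measurable center by exact: measurable_itv.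
have mleft : measurable left_end by exact: measurable_itv.
have mright : measurable right_end by exact: measurable_itv.
have mends : measurable (left_end `|` right_end) by exact: measurableU.
have ball_sub : unif_prob (dist_ball c r) <=
    unif_prob (center `|` (left_end `|` right_end)).
  apply: unif_probS => [||a [/= fa]]; first exact: measurable_dist_ball.
    exact: measurableU.
  rewrite in_itv /= => a01.
  have : circ_abs a c <= r by apply: le_trans fa; case: fP => /(_ _ _ a01 c01)/andP[].
  rewrite circ_abs_le ler_distl ler_normr /center /left_end /right_end /= !in_itv /=.
  by case/or3P => ?; [left|right; right|right; left]; lra.
have := unif_probU_le mcenter mends.
have := unif_probU_le mleft mright.
have center_le : unif_prob center <= c + r - (c - r) by apply: unif_prob_itv_le; lra.
have left_le : unif_prob left_end <= r - 0 by apply: unif_prob_itv_le.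
have right_le : unif_prob right_end <= 1 - (1 - r) by apply: unif_prob_itv_le; lra.
lra.
Qed.

Lemma unif_prob_dist_ball_eq1 c r : 0 <= c <= 1 -> 1 <= r -> unif_prob (dist_ball c r) = 1.
Proof.
move=> c01 r_ge1; apply/eqP; rewrite eq_le unif_prob_le1; last exact: measurable_dist_ball.
rewrite -unif_probT; apply: unif_probS => //; first exact: measurable_dist_ball.
move=> a [_]; rewrite /= in_itv /= => a01; apply: le_trans r_ge1.
exact: interval_distance_le1.
Qed.

Lemma unif_prob_dist_ball_ge c r : 0 <= c <= 1 -> 0 <= r <= 1 ->
  r / 2 <= unif_prob (dist_ball c r).
Proof.
move=> c01 r01.
have itv_sub lo hi : 0 <= lo -> hi <= 1 -> c - r <= lo -> hi <= c + r ->
    hi - lo <= unif_prob (dist_ball c r).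
  move=> lo_ge0 hi_le1 lo_ge hi_le; apply: le_trans (unif_prob_itv_ge lo_ge0 hi_le1) _.
  apply: unif_probS => // [|a [/=]]; first exact: measurable_dist_ball.
  rewrite !in_itv /= => a_itv a01; rewrite /dist_ball /=.
  by apply: le_trans (interval_distance_le_norm a01 c01) _; rewrite ler_distl; lra.
have [c_half|c_half] := leP c (1 / 2).
  by have := itv_sub c (c + r / 2); lra.
by have := itv_sub (c - r / 2) c; lra.
Qed.

Variables (d : nat) (y : 'I_d -> R).
Hypothesis y01 : cube_points y.

Lemma box_prob_dist_ball_le r : 0 <= r ->
  box_prob (fun j => dist_ball (y j) r) <= (4 * r) ^+ d.
Proof.
move=> r_ge0; rewrite -[X in _ ^+ X]card_ord -prodr_const; apply: ler_prod => j _.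
by rewrite unif_prob_ge0 unif_prob_dist_ball_le.
Qed.

Lemma box_prob_dist_ball_compl_le r : 0 <= r ->
  1 - box_prob (fun j => dist_ball (y j) r) <= expR (- (r / 2) ^+ d).
Proof.
move=> r_ge0; have [r_ge1|r_lt1] := leP 1 r.
  rewrite /box_prob big1 ?subrr ?expR_ge0// => j _; exact: unif_prob_dist_ball_eq1.
apply: le_trans (expR_ge1Dx _); rewrite lerD2l lerN2.
rewrite -[X in _ ^+ X]card_ord -prodr_const; apply: ler_prod => j _.
by rewrite divr_ge0//= unif_prob_dist_ball_ge// r_ge0 ltW.
Qed.

End IntervalDistance.

Section Regions.
Variable R : realType.

Lemma region_nonempty_farthest n d (dist : ('I_d -> R) -> ('I_d -> R) -> R)
    (dom : set ('I_d -> R)) (s : 'I_n -> 'I_d -> R) (om : 'I_n -> R) (A : {set 'I_n}) :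
  (forall i, 0 < om i) -> (0 < #|A|)%N -> region_nonempty dist dom s om A ->
  exists x r i0, [/\ dom x, i0 \in A, dist (s i0) x = om i0 * r,
    forall i, i \in A -> dist (s i) x <= om i * r
    & forall i, i \notin A -> om i * r <= dist (s i) x].
Proof.
move=> om_gt0 /card_gt0P[i1 i1A] [x [dom_x [r [in_le out_gt]]]].
pose scaled i := dist (s i) x / om i.
have [i0 i0A i0_max] := arg_maxP scaled i1A.
exists x, (scaled i0), i0; split=> // [|i iA|i iA].
- by rewrite mulrC divfK// gt_eqF.
- by rewrite mulrC -ler_pdivrMr//; exact: i0_max.
- apply/ltW/(le_lt_trans _ (out_gt i iA)); rewrite ler_pM2l//.
  by rewrite ler_pdivrMr// mulrC in_le.
Qed.

End Regions.

Section Discretization.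
Variables (R : realType) (f : R -> R -> R) (p : option nat) (d M : nat).
Hypothesis fP : interval_distance f.
Hypothesis d_gt0 : (0 < d)%N.
Hypothesis p_gt0 : forall q, p = Some q -> (0 < q)%N.
Hypothesis M_gt0 : (0 < M)%N.
Implicit Types (x s : 'I_d -> R) (om r : R).

Let M_gt0R : 0 < M%:R :> R. Proof. by rewrite ltr0n. Qed.
Let d_gt0R : 0 < d%:R :> R. Proof. by rewrite ltr0n. Qed.
Let d_ge1R : 1 <= d%:R :> R. Proof. by rewrite ler1n. Qed.

Definition grid_point (z : {ffun 'I_d -> 'I_M.+1}) : 'I_d -> R := fun j => (z j)%:R / M%:R.

Lemma cube_points_grid z : cube_points (grid_point z).
Proof.
move=> j; rewrite /grid_point divr_ge0//= ler_pdivrMr// mul1r ler_nat.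
by rewrite -ltnS ltn_ord.
Qed.

Definition near_grid_point x z : Prop := forall j, `|x j - grid_point z j| <= M%:R^-1.

Lemma near_grid_point_exists x : cube_points x -> exists z, near_grid_point x z.
Proof.
move=> x01; exists [ffun j => inord (Num.trunc (x j * M%:R))] => j.
have /andP[xj_ge0 xj_le1] := x01 j.
have /andP[lower upper] := truncn_itv (mulr_ge0 xj_ge0 (ltW M_gt0R)).
rewrite /grid_point ffunE inordK; last first.
  by rewrite ltnS -(ler_nat R) (le_trans lower)// ler_piMl.
set k := Num.trunc _ in lower upper *.
have -> : x j - k%:R / M%:R = (x j * M%:R - k%:R) / M%:R by rewrite mulrBl mulfK ?gt_eqF.
rewrite ger0_norm ?divr_ge0 ?subr_ge0// -[leRHS]mul1r ler_pM2r ?invr_gt0//.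
by rewrite lerBlDl natr1 ltW.
Qed.

Definition outer_radius (l : nat) : R := 4 * d%:R * 4 ^+ l / M%:R.

(* The shift by 3 absorbs the rounding to the grid; it makes the radius negative,
   hence the inner box empty, at scale 0. *)
Definition inner_radius (l : nat) : R := (4 ^+ l - 3) / M%:R.

Definition has_scale r (l : nat) : bool := 4 ^+ l <= M%:R * r / d%:R + 1 < 4 ^+ l.+1.

Lemma has_scale_exists r : 0 <= r <= d%:R -> exists l : 'I_M.+1, has_scale r l.
Proof.
move=> /andP[r_ge0 r_le]; set t := M%:R * r / d%:R + 1.
have t_ge1 : 1 <= t by rewrite lerDr divr_ge0 ?mulr_ge0.
have t_le : t <= M.+1%:R by rewrite -natr1 lerD2r ler_pdivrMr// ler_pM2l.
have /andP[lower upper] := truncn_itv (le_trans ler01 t_ge1).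
have trunc_gt0 : (0 < Num.trunc t)%N by rewrite -ltnS -(ltr_nat R) (le_lt_trans t_ge1).
have /andP[pow_le lt_pow] := trunc_log_bounds (isT : 1 < 4)%N trunc_gt0.
set l := trunc_log 4 _ in pow_le lt_pow.
have pow_le_t : 4 ^+ l <= t by rewrite (le_trans _ lower)// -natrX ler_nat.
have l_lt : (l < M.+1)%N.
  apply: leq_trans (ltn_expl l (isT : 1 < 4)%N) _.
  by rewrite -(ler_nat R) natrX (le_trans pow_le_t).
exists (Ordinal l_lt); rewrite /has_scale /= pow_le_t /= (lt_le_trans upper)//.
by rewrite -natrX ler_nat.
Qed.

Lemma dist_le_outer x s z om r l : cube_points x -> cube_points s -> 1 <= om ->
  near_grid_point x z -> has_scale r l -> pdist p f s x <= om * r ->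
  forall j, f (s j) (grid_point z j) <= om * outer_radius l.
Proof.
move=> x01 s01 om_ge1 near_z /andP[_ r_lt] dist_le j.
have f_ge0 i : 0 <= f (s i) (x i) by exact: interval_distance_ge0.
have grid01 := cube_points_grid z j.
apply: le_trans (interval_distance_leD fP (s01 j) (x01 j) grid01 (near_z j)) _.
have fj_le := le_trans (le_pdist p_gt0 f_ge0 j) dist_le.
have inv_le : M%:R^-1 <= om * (d%:R / M%:R).
  by rewrite mulrA ler_peMl ?invr_ge0// mulr_ege1.
apply: le_trans (lerD fj_le inv_le) _.
rewrite -mulrDr ler_pM2l; last exact: lt_le_trans om_ge1.
rewrite (_ : r + _ = (M%:R * r / d%:R + 1) * (d%:R / M%:R)); last first.
  by field; rewrite !gt_eqF.
rewrite (_ : outer_radius l = 4 ^+ l.+1 * (d%:R / M%:R)); last first.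
  by rewrite exprS /outer_radius; ring.
by rewrite ler_wpM2r ?divr_ge0// ltW.
Qed.

Lemma inner_lt_dist x s z om r l : cube_points x -> cube_points s -> 1 <= om ->
  near_grid_point x z -> has_scale r l -> om * r <= pdist p f s x ->
  exists j, om * inner_radius l < f (s j) (grid_point z j).
Proof.
move=> x01 s01 om_ge1 near_z /andP[r_ge _] dist_ge; apply/not_existsP => dist_le.
have f_ge0 i : 0 <= f (s i) (x i) by exact: interval_distance_ge0.
have om_gt0 : 0 < om by exact: lt_le_trans om_ge1.
have fj_le j : f (s j) (x j) <= om * ((4 ^+ l - 2) / M%:R).
  have near_x : `|grid_point z j - x j| <= M%:R^-1 by rewrite distrC.
  have grid01 := cube_points_grid z j.
  apply: le_trans (interval_distance_leD fP (s01 j) grid01 (x01 j) near_x) _.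
  have inner_le : f (s j) (grid_point z j) <= om * inner_radius l.
    by rewrite leNgt; apply/negP; exact: dist_le.
  have inv_le : M%:R^-1 <= om * M%:R^-1 by rewrite ler_peMl ?invr_ge0.
  apply: le_trans (lerD inner_le inv_le) _; rewrite /inner_radius.
  by rewrite [leRHS](_ : _ = om * ((4 ^+ l - 3) / M%:R) + om * M%:R^-1)//; ring.
have := le_trans dist_ge (pdist_le p_gt0 f_ge0 d_gt0 fj_le).
rewrite mulrCA ler_pM2l// => r_le.
have : M%:R * r / d%:R <= 4 ^+ l - 2.
  by rewrite ler_pdivrMr// -ler_pdivlMl// mulrC mulrAC mulrC.
by lra.
Qed.

End Discretization.

Section SiteEvents.
Variables (R : realType) (f : R -> R -> R) (p : option nat) (n d M : nat).
Hypothesis fP : interval_distance f.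
Hypothesis d_gt0 : (0 < d)%N.
Hypothesis M_gt0 : (0 < M)%N.
Variable om : 'I_n -> R.
Hypothesis om_ge1 : forall i, 1 <= om i.
Implicit Types (z : {ffun 'I_d -> 'I_M.+1}) (l : nat) (i : 'I_n) (A B : {set 'I_n}).

Let M_gt0R : 0 < M%:R :> R. Proof. by rewrite ltr0n. Qed.
Let d_ge1R : 1 <= d%:R :> R. Proof. by rewrite ler1n. Qed.
Let om_ge0 i : 0 <= om i. Proof. exact: le_trans (om_ge1 i). Qed.

Definition outer_set z l A i (j : 'I_d) : set R :=
  if i \in A then dist_ball f (grid_point R z j) (om i * outer_radius R d M l) else setT.

Definition inner_set z l B i (j : 'I_d) : set R :=
  if i \in B then set0 else dist_ball f (grid_point R z j) (om i * inner_radius R M l).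

(* Where site i has to lie if i0 |: B is the set of sites of a region of scale l having
   a point in the cell z, the farthest of these sites being i0. *)
Definition site_event z l i0 B i : set ('I_d -> R) :=
  box (outer_set z l (i0 |: B)%SET i) `\` box (inner_set z l B i).

Definition site_prob z l i0 B i : R :=
  box_prob (outer_set z l (i0 |: B)%SET i) - box_prob (inner_set z l B i).

Lemma measurable_outer_set z l A i j : measurable (outer_set z l A i j).
Proof. by rewrite /outer_set; case: ifP => // _; exact: measurable_dist_ball. Qed.

Lemma measurable_inner_set z l B i j : measurable (inner_set z l B i j).
Proof. by rewrite /inner_set; case: ifP => // _; exact: measurable_dist_ball. Qed.

Lemma inner_radius_le_outer l : inner_radius R M l <= outer_radius R d M l.
Proof.
rewrite ler_pM2r ?invr_gt0//.
have pow_ge1 : 1 <= 4 ^+ l :> R by rewrite exprn_ege1// ler1n.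
have pow_le : 4 ^+ l <= d%:R * 4 ^+ l :> R by rewrite ler_peMl// (le_trans ler01).
by lra.
Qed.

Lemma inner_set_sub_outer z l i0 B i j :
  inner_set z l B i j `<=` outer_set z l (i0 |: B)%SET i j.
Proof.
rewrite /inner_set /outer_set /dist_ball; case: (i \in B) => //; case: ifP => // _ a /= fa.
by rewrite (le_trans fa)// ler_wpM2l// inner_radius_le_outer.
Qed.

Lemma site_prob_ge0 z l i0 B i : 0 <= site_prob z l i0 B i.
Proof.
rewrite subr_ge0; apply: ler_prod => j _; rewrite unif_prob_ge0 /=.
apply: unif_probS; [exact: measurable_inner_set|exact: measurable_outer_set|].
by move=> a [+ _]; exact: inner_set_sub_outer.
Qed.

Hypothesis p_gt0 : forall q, p = Some q -> (0 < q)%N.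

Lemma region_site_event (dom : set ('I_d -> R)) (s : 'I_n -> 'I_d -> R) A :
  dom `<=` @cube_points R d -> (forall i, cube_points (s i)) -> (0 < #|A|)%N ->
  region_nonempty (pdist p f) dom s om A ->
  exists z (l : 'I_M.+1) i0, i0 \in A /\ forall i, site_event z l i0 (A :\ i0)%SET i (s i).
Proof.
move=> dom_cube s01 A_gt0 /region_nonempty_farthest[i|//|x].
  exact: lt_le_trans (om_ge1 i).
move=> [r [i0 [/dom_cube x01 i0A i0_far in_le out_ge]]].
have om0_gt0 : 0 < om i0 by exact: lt_le_trans (om_ge1 i0).
have f_ge0 j : 0 <= f (s i0 j) (x j) := interval_distance_ge0 fP (s01 i0 j) (x01 j).
have r_itv : 0 <= r <= d%:R.
  rewrite -(ler_pM2l om0_gt0) mulr0 -i0_far.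
  rewrite (le_trans (f_ge0 (Ordinal d_gt0)) (le_pdist p_gt0 f_ge0 _)) /=.
  rewrite -(ler_pM2l om0_gt0) -i0_far; apply: le_trans (_ : d%:R * 1 <= _).
    by apply: pdist_le => // j; exact: (interval_distance_le1 fP (s01 i0 j) (x01 j)).
  by rewrite mulr1 ler_peMl// (le_trans ler01).
have [z near_z] := near_grid_point_exists M_gt0 x01.
have [l r_scale] := has_scale_exists d_gt0 M_gt0 r_itv.
exists z, l, i0; split=> // i; rewrite /site_event finset.setD1K//.
split=> [j|in_inner].
  rewrite /outer_set; case: ifP => // iA.
  exact: (dist_le_outer fP d_gt0 p_gt0 M_gt0 x01 (s01 i) (om_ge1 i) near_z r_scale
    (in_le i iA)).
have [iB|iB] := boolP (i \in A :\ i0)%SET.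
  by have := in_inner (Ordinal d_gt0); rewrite /inner_set iB.
have dist_ge : om i * r <= pdist p f (s i) x.
  have [iA|] := boolP (i \in A); last exact: out_ge.
  by move: iB; rewrite !inE iA andbT negbK => /eqP->; rewrite i0_far.
have [j] := inner_lt_dist fP d_gt0 p_gt0 M_gt0 x01 (s01 i) (om_ge1 i) near_z r_scale
  dist_ge.
have := in_inner j.
by rewrite /inner_set (negbTE iB) /dist_ball /= => fj_le /lt_geF; rewrite fj_le.
Qed.

(* A cell, a scale and a farthest site. *)
Definition anchor : finType := ({ffun 'I_d -> 'I_M.+1} * 'I_M.+1 * 'I_n)%type.

Definition num_site_patterns k (s : 'I_n -> 'I_d -> R) : R :=
  \sum_(t : anchor) \sum_(B : {set 'I_n} | (#|B| == k) && (t.2 \notin B))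
    \prod_i \1_(site_event t.1.1 t.1.2 t.2 B i) (s i).

Lemma num_regions_le_site_patterns k (dom : set ('I_d -> R)) (s : 'I_n -> 'I_d -> R) :
  dom `<=` @cube_points R d -> (forall i, cube_points (s i)) ->
  (num_regions k.+1 (pdist p f) dom s om)%:R <= num_site_patterns k s.
Proof.
move=> dom_cube s01.
pose F (t : anchor) B : R := \prod_i \1_(site_event t.1.1 t.1.2 t.2 B i) (s i).
have F_ge0 t B : 0 <= F t B by apply: prodr_ge0 => i _; rewrite indicE ler0n.
apply: le_trans (_ : \sum_(A : {set 'I_n} | #|A| == k.+1)
    \sum_(t : anchor | t.2 \in A) F t (A :\ t.2)%SET <= _).
  rewrite /num_regions natr_sum; apply: ler_sum => A /eqP cardA.
  case: asboolP => [/region_site_event|_]; last by rewrite sumr_ge0.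
  rewrite cardA => -[]// z [l [i0 [i0A sites_in]]].
  rewrite (bigD1 (z, l, i0))//= {1}/F big1 => [|i _]; last by rewrite indicE mem_set.
  by rewrite lerDl sumr_ge0.
rewrite (exchange_big_dep xpredT)//=; apply: ler_sum => t _.
rewrite sum_subset_setU1 (eq_big (fun B => (#|B| == k) && (t.2 \notin B)) (F t))//.
  by move=> B; rewrite cardsU1; case: (t.2 \notin B); rewrite ?andbF.
by move=> B /andP[_ tB]; rewrite setU1K.
Qed.

Lemma expected_regions_le_site_probs k (dom : set ('I_d -> R)) (w : 'I_n -> R) :
  om = omega d w -> dom `<=` @cube_points R d ->
  (expected_regions k.+1 (pdist p f) dom w <=
    (\sum_(t : anchor) \sum_(B : {set 'I_n} | (#|B| == k) && (t.2 \notin B))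
      \prod_i site_prob t.1.1 t.1.2 t.2 B i)%:E)%E.
Proof.
move=> omE dom_cube.
apply: (@le_trans _ _
  (unif_expect (n * d) (fun v => (num_site_patterns k (sites_of v))%:E))).
  apply: le_unif_expect => v v01; rewrite lee_fin ?ler0n// -omE.
  by apply: num_regions_le_site_patterns => // i j; exact: v01.
rewrite /num_site_patterns; under eq_fun do rewrite pair_big_dep.
rewrite pair_big_dep (@unif_expect_sum_prod_box_setD _ (anchor * {set 'I_n})%type _ n d
  (fun e => outer_set e.1.1.1 e.1.1.2 (e.1.2 |: e.2)%SET)
  (fun e => inner_set e.1.1.1 e.1.1.2 e.2))//.
- by move=> *; exact: measurable_outer_set.
- by move=> *; exact: measurable_inner_set.
- by move=> e i x x_in j; apply: inner_set_sub_outer; exact: x_in.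
Qed.

Definition cell_rate i : R := (om i / M%:R) ^+ d.

Definition site_rate l i : R := (4 ^+ d) ^+ l * cell_rate i.

(* A ball of radius r <= 1 has probability between r / 2 and 4 r, inner radii are at
   least 4 ^ l / (4 M) at positive scales l, and outer radii are 4 d 4 ^ l / M. *)
Definition decay_const : R := 8^-1 ^+ d.
Definition volume_const : R := (16 * d%:R) ^+ d.

Lemma cell_rate_ge0 i : 0 <= cell_rate i.
Proof. by rewrite exprn_ge0// divr_ge0. Qed.

Lemma site_rate_ge0 l i : 0 <= site_rate l i.
Proof. by rewrite mulr_ge0 ?cell_rate_ge0// !exprn_ge0. Qed.

Lemma site_rateE l i : site_rate l i = (om i * 4 ^+ l / M%:R) ^+ d.
Proof. by rewrite /site_rate -exprM mulnC exprM -exprMn; congr (_ ^+ d); ring. Qed.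

Lemma decay_const_gt0 : 0 < decay_const.
Proof. by rewrite exprn_gt0. Qed.

Lemma decay_const_le1 : decay_const <= 1.
Proof. by rewrite exprn_ile1// invf_le1// ler1n. Qed.

Lemma volume_const_ge1 : 1 <= volume_const.
Proof. by rewrite exprn_ege1// -natrM ler1n muln_gt0. Qed.

Lemma box_prob_outer_le1 z l A i : box_prob (outer_set z l A i) <= 1.
Proof.
apply: prodr_ile1 => j _; rewrite unif_prob_ge0 unif_prob_le1//.
exact: measurable_outer_set.
Qed.

Lemma site_prob_le1 z l i0 B i : site_prob z l i0 B i <= 1.
Proof.
rewrite lerBlDr (le_trans (_ : _ <= 1))//; last by rewrite lerDl box_prob_ge0.
exact: box_prob_outer_le1.
Qed.

Lemma site_prob_le_volume z l i0 B i : i \in (i0 |: B)%SET ->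
  site_prob z l i0 B i <= volume_const * site_rate l i.
Proof.
move=> iA; rewrite lerBlDr (le_trans (_ : _ <= volume_const * site_rate l i))//; last first.
  by rewrite lerDl box_prob_ge0.
rewrite site_rateE -exprMn /outer_set iA.
rewrite (_ : 16 * d%:R * _ = 4 * (om i * outer_radius R d M l)); last first.
  by rewrite /outer_radius; ring.
apply: box_prob_dist_ball_le => //; first exact: cube_points_grid.
by rewrite mulr_ge0// divr_ge0// !mulr_ge0 ?exprn_ge0.
Qed.

Lemma site_prob_le_decay z l i0 B i : i \notin B ->
  site_prob z l i0 B i <= expR (cell_rate i) * expR (- (decay_const * site_rate l i)).
Proof.
move=> iB; rewrite -expRD; case: l => [|l].
  apply: le_trans (site_prob_le1 _ _ _ _ _) _; rewrite -expR0 ler_expR subr_ge0.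
  by rewrite /site_rate expr0 mul1r ler_piMl ?cell_rate_ge0 ?decay_const_le1.
apply: le_trans (_ : 1 - box_prob (inner_set z l.+1 B i) <= _).
  by rewrite lerD2r box_prob_outer_le1.
rewrite /inner_set (negbTE iB).
have scale_ge0 : 0 <= om i * 4 ^+ l.+1 / M%:R by rewrite divr_ge0// mulr_ge0 ?exprn_ge0.
have radius_ge : om i * 4 ^+ l.+1 / M%:R / 4 <= om i * inner_radius R M l.+1.
  rewrite -!mulrA ler_wpM2l// mulrA mulrAC ler_pM2r ?invr_gt0//.
  by have : 1 <= 4 ^+ l :> R; [rewrite exprn_ege1// ler1n|rewrite exprS; lra].
have grid01 := cube_points_grid R M_gt0 z.
apply: le_trans (box_prob_dist_ball_compl_le fP grid01 _) _; first lra.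
rewrite ler_expR -[leLHS]add0r lerD ?cell_rate_ge0// lerN2 site_rateE -exprMn.
by rewrite lerXn2r ?nnegrE; lra.
Qed.

Lemma site_prob_le_farthest z l B i : i \notin B ->
  site_prob z l i B i <= expR (cell_rate i) *
    (volume_const * expR decay_const * gamma_density decay_const (site_rate l i)).
Proof.
move=> iB; apply: le_gamma_density; rewrite ?volume_const_ge1 ?site_rate_ge0//.
- by rewrite -expR0 ler_expR cell_rate_ge0.
- exact/ltW/decay_const_gt0.
- by apply: site_prob_le_volume; rewrite setU11.
- exact: site_prob_le_decay.
Qed.

Lemma prod_site_prob_le z l i0 B : i0 \notin B ->
  \prod_i site_prob z l i0 B i <=
    expR (\sum_i cell_rate i) * (volume_const * expR decay_const) *
    marked_gamma_weight decay_const volume_const (site_rate l) i0 B.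
Proof.
move=> i0B; pose rate := site_rate l.
pose weight i : R := if i \in B then Num.min 1 (volume_const * rate i)
  else expR (- (decay_const * rate i)).
pose farthest_factor i : R :=
  if i == i0 then volume_const * expR decay_const * rate i else 1.
have prod_weight : \prod_i weight i = (\prod_(i in B) Num.min 1 (volume_const * rate i)) *
    expR (- (decay_const * \sum_(i | i \notin B) rate i)).
  rewrite (bigID (mem B)) /=; congr (_ * _).
    by apply: eq_bigr => i; rewrite /weight => ->.
  rewrite mulr_sumr -sumrN expR_sum.
  by apply: eq_bigr => i /negbTE; rewrite /weight => ->.
rewrite [leRHS](_ : _ = \prod_i (expR (cell_rate i) * (farthest_factor i * weight i))).
  apply: ler_prod => i _; rewrite site_prob_ge0//= /farthest_factor /weight.
  have [->|i_i0] := eqVneq i i0.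
    by rewrite (negbTE i0B) -mulrA site_prob_le_farthest.
  rewrite mul1r; case: ifP => [iB|/negbT iB]; last exact: site_prob_le_decay.
  have exp_ge1 : 1 <= expR (cell_rate i) by rewrite -expR0 ler_expR cell_rate_ge0.
  apply: le_trans (_ : Num.min 1 (volume_const * rate i) <= _).
    by rewrite le_min site_prob_le1 site_prob_le_volume// inE iB orbT.
  rewrite ler_peMl// le_min ler01 mulr_ge0 ?site_rate_ge0//.
  exact: le_trans volume_const_ge1.
rewrite !big_split /= -expR_sum -big_mkcond big_pred1_eq prod_weight.
by rewrite /rate /marked_gamma_weight; ring.
Qed.

Lemma sum_anchorE k (F : nat -> 'I_n -> {set 'I_n} -> R) :
  \sum_(t : anchor) \sum_(B : {set 'I_n} | (#|B| == k) && (t.2 \notin B))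
    F t.1.2 t.2 B =
  M.+1%:R ^+ d * \sum_(l < M.+1) \sum_(B : {set 'I_n} | #|B| == k)
    \sum_(i0 | i0 \notin B) F l i0 B.
Proof.
pose sumB l i0 := \sum_(B : {set 'I_n} | (#|B| == k) && (i0 \notin B)) F l i0 B.
rewrite -(pair_bigA _ (fun (zl : {ffun 'I_d -> 'I_M.+1} * 'I_M.+1) i0 => sumB zl.2 i0)) /=.
rewrite -(pair_bigA _ (fun (_ : {ffun 'I_d -> 'I_M.+1}) (l : 'I_M.+1) =>
  \sum_i0 sumB l i0)) /=.
rewrite sumr_const card_ffun !card_ord -[LHS]mulr_natl natrX; congr (_ * _).
apply: eq_bigr => l _.
rewrite (exchange_big_dep (fun B : {set 'I_n} => #|B| == k)) => [|i0 B _ /andP[]//].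
by apply: eq_bigr => B cardB; under eq_bigl do rewrite cardB.
Qed.

Lemma sum_site_prob_le k :
  \sum_(t : anchor) \sum_(B : {set 'I_n} | (#|B| == k) && (t.2 \notin B))
      \prod_i site_prob t.1.1 t.1.2 t.2 B i <=
    M.+1%:R ^+ d * (expR (\sum_i cell_rate i) * (volume_const * expR decay_const) *
      \sum_(l < M.+1) gamma_subset_sum decay_const volume_const k (site_rate l)).
Proof.
set factor := expR _ * _.
pose bound l i0 B :=
  factor * marked_gamma_weight decay_const volume_const (site_rate l) i0 B.
apply: le_trans (_ : \sum_(t : anchor)
    \sum_(B : {set 'I_n} | (#|B| == k) && (t.2 \notin B)) bound t.1.2 t.2 B <= _).
  by apply: ler_sum => t _; apply: ler_sum => B /andP[_ tB]; exact: prod_site_prob_le.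
rewrite sum_anchorE /bound.
under eq_bigr do under eq_bigr do rewrite -mulr_sumr sum_marked_gamma_weight.
by under eq_bigr do rewrite -mulr_sumr; rewrite -mulr_sumr.
Qed.

End SiteEvents.

Section Expectation.
Variable R : realType.

Lemma expected_regions0_le1 n d (dist : ('I_d -> R) -> ('I_d -> R) -> R)
    (dom : set ('I_d -> R)) (w : 'I_n -> R) :
  (expected_regions 0 dist dom w <= 1)%E.
Proof.
rewrite -(unif_expect_cst (n * d) 1); apply: le_unif_expect => v _; rewrite lee_fin//.
rewrite /num_regions (big_pred1 finset.set0) => [|A]; last by rewrite /= cards_eq0.
by rewrite lern1 leq_b1.
Qed.

Lemma grid_size_exists d (W : R) : (0 < d)%N -> 1 <= W ->
  exists2 M, (0 < M)%N & W <= M%:R ^+ d /\ M.+1%:R ^+ d <= 3 ^+ d * W.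
Proof.
move=> d_gt0 W_ge1; set side := W `^ d%:R^-1.
have W_ge0 : 0 <= W by exact: le_trans W_ge1.
have sideX : side ^+ d = W by exact: powR_invnK.
have side_ge1 : 1 <= side by rewrite -(ler_pXn2r d_gt0) ?nnegrE ?powR_ge0// sideX expr1n.
have /andP[lower upper] := truncn_itv (powR_ge0 W d%:R^-1).
exists (Num.trunc side).+1 => //; rewrite -sideX -exprMn.
by rewrite !lerXn2r ?nnegrE// -?natr1; move: lower upper; rewrite -/side -?natr1; lra.
Qed.

Lemma omega_ge1 n d (w : 'I_n -> R) i : (0 < d)%N -> 1 <= w i -> 1 <= omega d w i.
Proof.
move=> d_gt0 w_ge1.
by rewrite -(ler_pXn2r d_gt0) ?nnegrE ?powR_ge0// powR_invnK ?expr1n// (le_trans ler01).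
Qed.

Lemma sum_cell_rate_omega n d M (w : 'I_n -> R) : (0 < d)%N -> (forall i, 1 <= w i) ->
  \sum_i cell_rate d M (omega d w) i = (\sum_i w i) / M%:R ^+ d.
Proof.
move=> d_gt0 w_ge1; rewrite mulr_suml; apply: eq_bigr => i _.
by rewrite /cell_rate expr_div_n powR_invnK// (le_trans ler01).
Qed.

Definition linear_region_bound d k (p : option nat) (K : R) : Prop :=
  forall (f : R -> R -> R) (dom : set ('I_d -> R)),
    interval_distance f -> dom `<=` @cube_points R d ->
    forall (n : nat) (w : 'I_n -> R), (forall i, 1 <= w i) -> 1 <= \sum_(i < n) w i ->
    (expected_regions k (pdist p f) dom w <= (K * \sum_(i < n) w i)%:E)%E.

Lemma linear_region_bound0 d p : linear_region_bound d 0 p 1.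
Proof.
move=> f dom _ _ n w _ W_ge1.
by apply: le_trans (expected_regions0_le1 _ _ _) _; rewrite mul1r lee_fin.
Qed.

Lemma linear_region_boundS_exists d k p : (0 < d)%N ->
  (forall q, p = Some q -> (0 < q)%N) ->
  exists2 K, 0 <= K & linear_region_bound d k.+1 p K.
Proof.
move=> d_gt0 p_gt0.
have base_ge2 : 2 <= 4 ^+ d :> R.
  apply: le_trans (_ : 4 <= _); first by rewrite ler_nat.
  by rewrite -[leLHS]expr1 ler_weXn2l// ler1n.
have volume_ge0 : 0 <= volume_const R d by exact: le_trans (volume_const_ge1 R d_gt0).
have [K K_ge0 sum_leK] :=
  geometric_gamma_subset_sum_bounded k (decay_const_gt0 R d) volume_ge0 base_ge2.
pose factor : R := volume_const R d * expR (decay_const R d).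
have factor_ge0 : 0 <= factor by rewrite mulr_ge0 ?expR_ge0.
exists (3 ^+ d * (expR 1 * factor) * K) => [|f dom fP dom_cube n w w_ge1 W_ge1].
  by rewrite !mulr_ge0 ?expR_ge0 ?exprn_ge0.
have [M M_gt0 [W_leM M_leW]] := grid_size_exists d_gt0 W_ge1.
have om_ge1 i := omega_ge1 d_gt0 (w_ge1 i).
have expected_le :=
  expected_regions_le_site_probs fP d_gt0 M_gt0 om_ge1 p_gt0 k erefl dom_cube.
apply: le_trans expected_le _.
rewrite lee_fin; apply: le_trans (sum_site_prob_le fP d_gt0 M_gt0 om_ge1 k) _.
have gamma_ge0 (l : 'I_M.+1) : 0 <= gamma_subset_sum (decay_const R d) (volume_const R d) k
    (site_rate d M (omega d w) l).
  by apply: sumr_ge0 => B _; apply: gamma_weight_ge0 => // i; rewrite site_rate_ge0.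
rewrite [leRHS](_ : _ = 3 ^+ d * (\sum_i w i) * (expR 1 * factor * K)); last by ring.
rewrite ler_pM// ?exprn_ge0// ?mulr_ge0 ?sumr_ge0 ?expR_ge0//.
rewrite ler_pM ?mulr_ge0 ?sumr_ge0 ?expR_ge0//.
  rewrite ler_wpM2r// ler_expR.
  by rewrite sum_cell_rate_omega// ler_pdivrMr ?mul1r// exprn_gt0 ?ltr0n.
by apply: sum_leK => i; rewrite cell_rate_ge0.
Qed.

Lemma linear_region_bound_exists d k p : (0 < d)%N ->
  (forall q, p = Some q -> (0 < q)%N) ->
  exists2 K, 0 <= K & linear_region_bound d k p K.
Proof.
case: k => [|k]; last exact: linear_region_boundS_exists.
by exists 1 => //; exact: linear_region_bound0.
Qed.

End Expectation.

Theorem mainTheorem12 (R : realType) (d k : nat) (p : option nat) :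
  (0 < d)%N -> (forall q, p = Some q -> (0 < q)%N) ->
  exists C : R, 0 < C /\
    forall (n : nat) (w : 'I_n -> R),
      (forall i, 1 <= w i) -> (exists i, w i = 1) ->
      (expected_regions k (@torus_dist R p d) (@torus_points R d) w
         <= (C * \sum_(i < n) w i)%:E)%E /\
      (expected_regions k (@cube_dist R p d) (@cube_points R d) w
         <= (C * \sum_(i < n) w i)%:E)%E.
Proof.
move=> d_gt0 p_gt0.
have [K K_ge0 expected_leK] := linear_region_bound_exists R k d_gt0 p_gt0.
exists (K + 1); split=> [|n w w_ge1 [i0 _]]; first by rewrite ltr_wpDl.
have W_ge1 : 1 <= \sum_(i < n) w i.
  rewrite (bigD1 i0)//= (le_trans (w_ge1 i0))// lerDl sumr_ge0// => i _.
  by rewrite (le_trans _ (w_ge1 i)).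
have KW_le : ((K * \sum_(i < n) w i)%:E <= ((K + 1) * \sum_(i < n) w i)%:E)%E.
  by rewrite lee_fin ler_wpM2r ?lerDl// (le_trans ler01).
split; apply: le_trans KW_le; apply: expected_leK => //.
- exact: interval_distance_circ.
- by move=> x x01 j; have /andP[-> /ltW] := x01 j.
- exact: interval_distance_norm.
Qed.
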